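(* Let $\delta\in(0,1)$ and consider epoch $t$ of the random reshuffling method (RR) with a step size $\alpha_t>0$ satisfying $$4\alpha_t nL\le1.$$ Then, with probability at least $1-\delta$, $$\|e_t\|^2\le 2\alpha_t^2n^2L^2\|\nabla f(x_t)\|^2+32\alpha_t^2nL^2\left(A\,(f(x_t)-\bar f)+B\right)\log^2(8n/\delta).$$
   Context: Here $f(x)=\frac1n\sum_{i=1}^n f_i(x)$ on $\mathbb{R}^d$. Each $f_i:\mathbb{R}^d\to\mathbb{R}$ is continuously differentiable (not necessarily convex), bounded from below by $\bar f_i\in\mathbb{R}$, and $\nabla f_i$ is Lipschitz continuous with parameter $L>0$. Let $\bar f$ be a lower bound of $f$ (e.g. its optimal value), and set $A=2L>0$ and $B=\frac{A}{n}\sum_{i=1}^n(\bar f-\bar f_i)$, with $\bar f$ such that $B\ge0$ (automatic if $\bar f=\inf f$). $\|\cdot\|$ is the Euclidean norm. RR: let $\Pi$ be the set of all permutations of $\{1,\dots,n\}$. At epoch $t=0,1,\dots$, a permutation $\pi_t=(\pi_t^1,\dots,\pi_t^n)$ is sampled uniformly at random from $\Pi$, independently of the past (so independently of $x_t$); set $x_t^0=x_t$, $x_t^i=x_t^{i-1}-\alpha_t\nabla f_{\pi_t^i}(x_t^{i-1})$ for $i=1,\dots,n$, and $x_{t+1}=x_t^n$. Step sizes are deterministic. Define $$g_t=\frac1n\sum_{i=1}^n\nabla f_{\pi_t^i}(x_t^{i-1}),\qquad e_t=g_t-\nabla f(x_t).$$ *)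

(* Defs.v *)
From HB Require Import structures.
From mathcomp Require Import all_boot all_order all_fingroup all_algebra.
From mathcomp Require Import all_classical all_reals all_analysis.

Set Implicit Arguments.
Unset Strict Implicit.
Unset Printing Implicit Defensive.

Import Order.TTheory GRing.Theory Num.Theory.
Import numFieldNormedType.Exports.
Local Open Scope classical_set_scope.
Local Open Scope ring_scope.

(** The library norm [`|v|] on ['rV[R]_d] is the max norm; since all norms on
    R^d are equivalent, topology and differentiability are unaffected, but
    Lipschitz constants and error bounds have to be stated with the Euclidean
    norm. *)
Definition enorm (R : realType) (d : nat) (v : 'rV[R]_d) : R :=
  Num.sqrt (\sum_(i < d) v ord0 i ^+ 2).

Definition grad (R : realType) (d : nat) (h : 'rV[R]_d -> R) (x : 'rV[R]_d) :
  'rV[R]_d := \row_(i < d) 'D_(delta_mx ord0 i) h x.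

Definition cont_diff (R : realType) (d : nat) (h : 'rV[R]_d -> R) : Prop :=
  (forall x, differentiable h x) /\ continuous (grad h).

Definition lipschitz_grad (R : realType) (d : nat) (L : R)
    (h : 'rV[R]_d -> R) : Prop :=
  forall x y, enorm (grad h x - grad h y) <= L * enorm (x - y).

Definition favg (R : realType) (d n : nat) (f : 'I_n -> 'rV[R]_d -> R)
  (x : 'rV[R]_d) : R := n%:R^-1 * \sum_(i < n) f i x.

Section RandomReshuffling.
Context {R : realType} {d n : nat}.
Variable f : 'I_n -> 'rV[R]_d -> R.

(** Components and positions are numbered from 0: [s i] is the component used
    at the [i]-th inner step, and [rr_inner a s x k] is the point reached from
    [x] after the first [k] inner steps (for [k <= n]) with step size [a] and
    permutation [s]. *)
Definition rr_inner (a : R) (s : 'S_n) (x : 'rV[R]_d) (k : nat) : 'rV[R]_d :=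
  foldl (fun y i => y - a *: grad (f (s i)) y) x (take k (enum 'I_n)).

Definition rr_g (a : R) (s : 'S_n) (x : 'rV[R]_d) : 'rV[R]_d :=
  n%:R^-1 *: \sum_(i < n) grad (f (s i)) (rr_inner a s x i).

Definition rr_e (a : R) (s : 'S_n) (x : 'rV[R]_d) : 'rV[R]_d :=
  rr_g a s x - grad (favg f) x.

Fixpoint rr_iter (T : Type) (alpha : nat -> R) (x0 : T -> 'rV[R]_d)
    (pi : nat -> T -> 'S_n) (t : nat) (w : T) : 'rV[R]_d :=
  if t is t'.+1 then
    rr_inner (alpha t') (pi t' w) (rr_iter alpha x0 pi t' w) n
  else x0 w.

End RandomReshuffling.

(** The sigma-algebra generated by the initial point (Borel subsets of R^d
    being generated by the open ones) and by the permutations drawn before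
    epoch [t]. *)
Definition rr_past (R : realType) (d n : nat) (T : Type)
    (x0 : T -> 'rV[R]_d) (pi : nat -> T -> 'S_n) (t : nat) : set (set T) :=
  <<s [set E | (exists2 U, open U & E = x0 @^-1` U) \/
               (exists u s, (u < t)%N /\ E = pi u @^-1` [set s])] >>.

(** The initial point may be random (a constant [x0] gives a deterministic
    one); each [pi t] is uniform over the permutations and independent of the
    past. *)
Definition rr_sampling (R : realType) (d n : nat) (disp : measure_display)
    (T : measurableType disp) (P : probability T R)
    (x0 : T -> 'rV[R]_d) (pi : nat -> T -> 'S_n) : Prop :=
  [/\ forall U, open U -> measurable (x0 @^-1` U),
      forall t s, measurable (pi t @^-1` [set s]),
      forall t s, P (pi t @^-1` [set s]) = ((n`!)%:R^-1)%:E &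
      forall t s E, rr_past x0 pi t E ->
        P (E `&` pi t @^-1` [set s]) = (P E * P (pi t @^-1` [set s]))%E].

(* Main.v *)
(** Let [V = A (f x - fbar) + B] and let [w_i = grad f_i x - grad f x].  Since
    [fbar_i] bounds [f_i] from below, the descent lemma gives
    [|grad f_i x|^2 <= 2 L (f_i x - fbar_i)], so that [sum_i |w_i|^2 <= n V].
    The Lipschitz property and [4 a n L <= 1] bound [|e|] by
    [4/3 a L (n/2 |grad f x| + M)], where [M] is the largest norm of a partial
    sum [sum_(j < k) w_(s j)].  These partial sums are sums without
    replacement of vectors of mean zero: their means form a reverse martingale,
    and comparing [exp (sqrt (1 + |y|^2))] along it yields a dimension-free
    exponential moment, hence [M <= 3 sqrt (n V) ln (8 n / delta)] for all but
    a fraction [delta] of the permutations.  As the current permutation is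
    uniform and independent of [x_t], this fraction bounds the probability. *)

Require Import Defs.
From mathcomp Require Import all_boot all_order all_fingroup all_algebra.
From mathcomp Require Import ring lra.
From mathcomp Require Import all_classical all_reals all_analysis.
From mathcomp Require Import measurable_realfun.

Set Implicit Arguments.
Unset Strict Implicit.
Unset Printing Implicit Defensive.

Import Order.TTheory GRing.Theory Num.Theory.
Import numFieldNormedType.Exports.
Local Open Scope classical_set_scope.
Local Open Scope ring_scope.

(** * Inner product and Euclidean norm on row vectors *)

Section Euclidean.
Context {R : realType} {d : nat}.
Implicit Types u v w : 'rV[R]_d.

Definition dotv u v : R := \sum_(i < d) u ord0 i * v ord0 i.

Lemma dotvC u v : dotv u v = dotv v u.
Proof. by apply: eq_bigr => i _; rewrite mulrC. Qed.

Lemma dotvDl u v w : dotv (u + v) w = dotv u w + dotv v w.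
Proof. by rewrite -big_split; apply: eq_bigr => i _; rewrite mxE mulrDl. Qed.

Lemma dotvZl a u w : dotv (a *: u) w = a * dotv u w.
Proof. by rewrite mulr_sumr; apply: eq_bigr => i _; rewrite mxE mulrA. Qed.

Lemma dotvDr u v w : dotv u (v + w) = dotv u v + dotv u w.
Proof. by rewrite dotvC dotvDl !(dotvC u). Qed.

Lemma dotvZr a u v : dotv u (a *: v) = a * dotv u v.
Proof. by rewrite dotvC dotvZl dotvC. Qed.

Lemma dotvNl u v : dotv (- u) v = - dotv u v.
Proof. by rewrite -scaleN1r dotvZl mulN1r. Qed.

Lemma dotv0r u : dotv u 0 = 0.
Proof. by rewrite /dotv big1// => i _; rewrite mxE mulr0. Qed.

Lemma dotv_sumr (I : finType) (P : pred I) u (F : I -> 'rV[R]_d) :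
  dotv u (\sum_(i | P i) F i) = \sum_(i | P i) dotv u (F i).
Proof.
by elim/big_rec2: _ => [|i x y _ <-]; rewrite ?dotv0r// dotvDr.
Qed.

Lemma enormE u : enorm u ^+ 2 = dotv u u.
Proof. by rewrite /enorm sqr_sqrtr ?sumr_ge0// => i _; exact: sqr_ge0. Qed.

Lemma enorm_ge0 u : 0 <= enorm u.
Proof. exact: sqrtr_ge0. Qed.

Lemma enorm0 : enorm (0 : 'rV[R]_d) = 0.
Proof. by apply/eqP; rewrite -sqrf_eq0 enormE dotv0r. Qed.

Lemma enorm_eq0 u : enorm u = 0 -> u = 0.
Proof.
move=> u0; have := enormE u; rewrite u0 expr0n/= => /esym/eqP.
rewrite psumr_eq0 => [/allP h|i _]; last exact: sqr_ge0.
apply/rowP => i; rewrite mxE; apply/eqP.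
by rewrite -sqrf_eq0 expr2; apply: (h i); rewrite mem_index_enum.
Qed.

Lemma enormZ a u : enorm (a *: u) = `|a| * enorm u.
Proof.
apply/eqP; rewrite -(eqrXn2 (n := 2))// ?mulr_ge0 ?enorm_ge0//.
by rewrite exprMn !enormE dotvZl dotvZr real_normK ?num_real// mulrA.
Qed.

Lemma enormN u : enorm (- u) = enorm u.
Proof. by rewrite -scaleN1r enormZ normrN1 mul1r. Qed.

Lemma enormD_sqr u v :
  enorm (u + v) ^+ 2 = enorm u ^+ 2 + 2 * dotv u v + enorm v ^+ 2.
Proof. by rewrite !enormE dotvDl !dotvDr (dotvC v u); ring. Qed.

Lemma dotv_le u v : dotv u v <= enorm u * enorm v.
Proof.
have [v0|v0] := eqVneq (enorm v) 0.
  by rewrite v0 (enorm_eq0 v0) dotv0r mulr0.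
have vgt0 : 0 < enorm v by rewrite lt_def v0 enorm_ge0.
have h : dotv u v ^+ 2 <= (enorm u * enorm v) ^+ 2.
  (* Cauchy-Schwarz: this square expands to |v|^2 (|u|^2 |v|^2 - (u.v)^2), and the factor |v|^2 > 0
     divides out. *)
  have := sqr_ge0 (enorm (enorm v ^+ 2 *: u - dotv u v *: v)).
  rewrite -scaleNr enormD_sqr !enormZ dotvZl dotvZr !exprMn.
  rewrite !real_normK ?num_real// sqrrN => h.
  rewrite -subr_ge0 -(@pmulr_rge0 _ (enorm v ^+ 2)) ?exprn_gt0//.
  by congr (is_true (0 <= _)): h; ring.
apply: (le_trans (ler_norm _)).
by rewrite -(@ler_pXn2r _ 2)// ?nnegrE ?mulr_ge0 ?enorm_ge0// real_normK ?num_real.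
Qed.

Lemma ler_enormD u v : enorm (u + v) <= enorm u + enorm v.
Proof.
rewrite -(@ler_pXn2r _ 2)// ?nnegrE ?addr_ge0 ?enorm_ge0// enormD_sqr.
by have := dotv_le u v; lra.
Qed.

Lemma ler_enorm_sum (I : finType) (P : pred I) (F : I -> 'rV[R]_d) :
  enorm (\sum_(i | P i) F i) <= \sum_(i | P i) enorm (F i).
Proof.
elim/big_rec2: _ => [|i x y _ h]; first by rewrite enorm0.
by rewrite (le_trans (ler_enormD _ _))// lerD2l.
Qed.

End Euclidean.

(** * An exponential potential and its second-order growth *)

Lemma expR_le_quad (R : realType) (u : R) : u <= 2^-1 ->
  expR u <= 1 + u + 2 * u ^+ 2.
Proof.
move=> u2; have u1 : 0 < 1 - u by lra.
(* This is exp(-u) >= 1 - u. It then suffices that (1 + u + 2 u^2)(1 - u) = 1 + u^2 (1 - 2 u) is at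
   least 1. *)
have h : expR u * (1 - u) <= 1.
  rewrite -[leRHS](mulfV (lt0r_neq0 (expR_gt0 u))) -expRN.
  by rewrite ler_pM2l ?expR_gt0// expR_ge1Dx.
rewrite -(ler_pM2r u1) (le_trans h)//.
have : 0 <= u ^+ 2 * (1 - 2 * u) by rewrite mulr_ge0 ?sqr_ge0//; lra.
lra.
Qed.

Section Potential.
Context {R : realType} {d : nat}.
Implicit Types y z : 'rV[R]_d.

(** A substitute for [expR (enorm y)] that is smooth at [0]. *)
Definition potential y : R := expR (Num.sqrt (1 + enorm y ^+ 2)).

Lemma potential_gt0 y : 0 < potential y.
Proof. exact: expR_gt0. Qed.

Lemma expR_enorm_le_potential y : expR (enorm y) <= potential y.
Proof.
rewrite ler_expR -[leLHS]ger0_norm ?enorm_ge0// -sqrtr_sqr ler_wsqrtr//.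
by rewrite lerDr.
Qed.

(** A tangent bound for the square root, followed by [expR_le_quad]. The term linear in [z] is kept
    exact so that it cancels over increments of sum zero. *)
Lemma potentialD_le y z : enorm z <= 3^-1 ->
  potential (y + z) <= potential y *
    (1 + dotv y z / Num.sqrt (1 + enorm y ^+ 2) + 4 * enorm z ^+ 2).
Proof.
move=> z3; rewrite /potential enormD_sqr.
set r := Num.sqrt (1 + enorm y ^+ 2); set s := enorm z; set p := dotv y z.
have s3 : s <= 3^-1 by [].
have s0 : 0 <= s by exact: enorm_ge0.
have r2 : r ^+ 2 = 1 + enorm y ^+ 2 by rewrite sqr_sqrtr// addr_ge0// sqr_ge0.
have r1 : 1 <= r.
  by rewrite -[leLHS]sqrtr1 ler_wsqrtr// lerDl sqr_ge0.
have r0 : 0 < r by lra.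
have yr : enorm y <= r.
  rewrite -(@ler_pXn2r _ 2)// ?nnegrE ?enorm_ge0//; first by lra.
  exact: ltW.
have pub : p <= r * s.
  by apply: (le_trans (dotv_le y z)); rewrite ler_wpM2r.
have plb : - (r * s) <= p.
  rewrite lerNl -dotvNl (le_trans (dotv_le _ z))// enormN.
  by rewrite ler_wpM2r.
(* The tangent increment of the square root at r^2: (r + u)^2 = r^2 + 2 p + s^2 + u^2. *)
pose u := p / r + s ^+ 2 / (2 * r).
have q1 : p / r <= s by rewrite ler_pdivrMr// mulrC.
have q2 : - s <= p / r by rewrite ler_pdivlMr// mulNr mulrC.
have q3 : s ^+ 2 / (2 * r) <= s ^+ 2 / 2.
  by rewrite ler_wpM2l ?sqr_ge0// lef_pV2 ?posrE; lra.
have q4 : 0 <= s ^+ 2 / (2 * r) by rewrite divr_ge0 ?sqr_ge0//; lra.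
have s2 : s ^+ 2 <= s / 3 by rewrite expr2 ler_wpM2l.
have hu : Num.sqrt (1 + (enorm y ^+ 2 + 2 * p + s ^+ 2)) <= r + u.
  have ru0 : 0 <= r + u by rewrite /u; lra.
  rewrite -[leRHS]ger0_norm// -sqrtr_sqr ler_wsqrtr// addrA addrA -r2.
  rewrite sqrrD.
  have -> : r * u = p + s ^+ 2 / 2 by rewrite /u; field; lra.
  by have := sqr_ge0 u; lra.
apply: (@le_trans _ _ (expR (r + u))); first by rewrite ler_expR.
rewrite expRD ler_pM2l ?expR_gt0//.
apply: (le_trans (expR_le_quad _)); first by rewrite /u; lra.
(* As s <= 1/3, |u| <= s + s^2/2 <= 7/6 s, and s^2/2 + 2 (7/6 s)^2 = 29/9 s^2 fits under 4 s^2. *)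
have u2 : u ^+ 2 <= (7 / 6 * s) ^+ 2.
  have ua : `|u| <= 7 / 6 * s by rewrite ler_norml /u; apply/andP; split; lra.
  rewrite -(real_normK (num_real u)) lerXn2r ?nnegrE//; lra.
by move: u2 q3; rewrite exprMn /u; lra.
Qed.

Lemma sum_potentialD_le (I : finType) (Q : pred I) y (F : I -> 'rV[R]_d) :
  \sum_(i | Q i) F i = 0 -> (forall i, Q i -> enorm (F i) <= 3^-1) ->
  \sum_(i | Q i) potential (y + F i) <=
  potential y * (#|Q|%:R + 4 * \sum_(i | Q i) enorm (F i) ^+ 2).
Proof.
move=> F0 F3; apply: (le_trans (ler_sum _ (fun i Qi => potentialD_le y (F3 i Qi)))).
rewrite -mulr_sumr !big_split/= -mulr_suml -dotv_sumr F0 dotv0r mul0r addr0.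
by rewrite sumr_const mulr_sumr.
Qed.

End Potential.

(** * Partial sums of vectors drawn without replacement *)

Lemma card_ord_lt (n k : nat) : (k <= n)%N -> #|[pred i : 'I_n | (i < k)%N]| = k.
Proof.
by move=> kn; rewrite -sum1_card -(big_ord_widen n (fun=> 1%N) kn) sum1_card card_ord.
Qed.

Section SamplingWithoutReplacement.
Context {R : realType} {d n : nat}.
Variable w : 'I_n -> 'rV[R]_d.

Definition psum (s : 'S_n) (k : nat) : 'rV[R]_d := \sum_(i < n | (i < k)%N) w (s i).

(** The product applies the transposition first, so draw [s i] moves to position [m], and the first
    [m] draws are the old first [m.+1] without [s i]. *)
Lemma psum_tperm (s : 'S_n) (m : 'I_n) (i : 'I_n) : (i <= m)%N ->
  psum (tperm i m * s)%g m = psum s m.+1 - w (s i).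
Proof.
move=> im; apply/(canRL (addrK _)); rewrite /psum.
rewrite [RHS](reindex_inj (@perm_inj _ (tperm i m))) /= [RHS](bigD1 m)/=; last first.
  by rewrite tpermR ltnS.
rewrite tpermR addrC; congr (_ + _); apply: eq_big => j; last by rewrite permM.
case: tpermP => [->|->|/eqP ji /eqP jm].
- by rewrite ltnS leqnn/= ltn_neqAle im andbT.
- by rewrite ltnn eqxx andbF.
- by rewrite jm andbT ltn_neqAle jm ltnS.
Qed.

(** Averaging over all [s] the sum over [i <= m] of the exchanges of positions
    [i] and [m] shows that, given the first [m.+1] draws as a set, each of them
    is equally likely to be the last one. *)
Lemma sum_perm_psum (G : 'rV[R]_d -> R) (m : 'I_n) :
  m.+1%:R * \sum_(s : 'S_n) G (psum s m) =
  \sum_(s : 'S_n) \sum_(i < n | (i < m.+1)%N) G (psum s m.+1 - w (s i)).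
Proof.
rewrite exchange_big/= mulr_natl.
rewrite -{1}(card_ord_lt (ltn_ord m)) -sumr_const.
apply: eq_big => i; first by rewrite inE.
rewrite inE ltnS => im.
rewrite (reindex_inj (mulgI (tperm i m))) /=.
by apply: eq_bigr => s _; rewrite psum_tperm.
Qed.

Hypothesis w_le : \sum_i enorm (w i) ^+ 2 <= (3^-1) ^+ 2.

(** The means [m^-1 *: psum s m] form a reverse martingale in [m]; rescaling by
    [k] makes its last term [psum s k]. *)
Lemma sum_potential_step (k : nat) (m : 'I_n) : (0 < k <= m)%N ->
  \sum_(s : 'S_n) potential ((k%:R / m%:R) *: psum s m) <=
  expR (4 / 9 * (k%:R / m%:R - k%:R / m.+1%:R)) *
  \sum_(s : 'S_n) potential ((k%:R / m.+1%:R) *: psum s m.+1).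
Proof.
move=> /andP[k0 km].
have m0 : (0 : R) < m%:R by rewrite ltr0n (leq_trans k0).
have m1 : (0 : R) < m.+1%:R by rewrite ltr0n.
rewrite -(ler_pM2l m1) (sum_perm_psum (fun v => potential ((k%:R / m%:R) *: v))).
rewrite mulrCA mulr_sumr mulr_sumr; apply: ler_sum => s _.
pose Q := [pred i : 'I_n | (i < m.+1)%N].
have cQ : #|Q| = m.+1.
  exact: card_ord_lt.
pose c : R := k%:R / m%:R.
have c0 : 0 < c by rewrite /c divr_gt0// ltr0n.
have c1 : c <= 1 by rewrite /c ler_pdivrMr// mul1r ler_nat.
(* With [b] the mean of the first [m.+1] draws, removing draw [i] leaves m b + (b - w (s i)), and
   these increments sum to zero over [i]. *)
pose b := m.+1%:R^-1 *: psum s m.+1.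
have sum_b : \sum_(i < n | Q i) (b - w (s i)) = 0.
  rewrite sumrB sumr_const cQ -scaler_nat scalerA mulfV ?gt_eqF// scale1r.
  exact: subrr.
(* Squares about the mean sum to at most the raw squares, hence to at most 1/9; so each increment
   also meets the radius 1/3 of [potentialD_le]. *)
have sum_b2 : \sum_(i < n | Q i) enorm (b - w (s i)) ^+ 2 <= (3^-1) ^+ 2.
  apply: le_trans w_le; rewrite [leRHS](reindex_inj (@perm_inj _ s)) /=.
  rewrite [leRHS](bigID Q)/= ler_wpDr ?sumr_ge0//; first by move=> *; exact: sqr_ge0.
  have h i : enorm (w (s i)) ^+ 2 =
      enorm (b - w (s i)) ^+ 2 - enorm b ^+ 2 + 2 * dotv b (w (s i)).
    rewrite enormD_sqr enormN [dotv b (- _)]dotvC dotvNl dotvC; ring.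
  under [leRHS]eq_bigr do rewrite h.
  rewrite !big_split/= -mulr_sumr -dotv_sumr sumr_const cQ.
  have -> : \sum_(i < n | Q i) w (s i) = m.+1%:R *: b.
    by rewrite scalerA mulfV ?gt_eqF// scale1r.
  rewrite dotvZr -enormE -addrA lerDl mulNrn -mulr_natl.
  by rewrite (_ : _ + _ = m.+1%:R * enorm b ^+ 2); [rewrite mulr_ge0 ?sqr_ge0|ring].
have hb i : Q i -> enorm (b - w (s i)) <= 3^-1.
  move=> Qi; rewrite -(@ler_pXn2r _ 2)// ?nnegrE ?enorm_ge0//.
  apply: le_trans sum_b2; rewrite (bigD1 i)//= lerDl sumr_ge0// => *.
  exact: sqr_ge0.
have := @sum_potentialD_le R d _ Q (c *: (m%:R *: b)) (fun i => c *: (b - w (s i))).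
rewrite -scaler_sumr sum_b scaler0 => /(_ erefl) h.
have Hpt i : c *: (m%:R *: b) + c *: (b - w (s i)) = c *: (psum s m.+1 - w (s i)).
  rewrite -scalerDr addrA -[X in _ + X - _]scale1r -scalerDl natr1.
  by rewrite scalerA mulfV ?gt_eqF// scale1r.
have Hc : c *: (m%:R *: b) = (k%:R / m.+1%:R) *: psum s m.+1.
  by rewrite !scalerA /c mulfVK ?gt_eqF.
rewrite Hc in h.
under eq_bigr do rewrite -Hpt Hc.
apply: le_trans (h _) _ => [i Qi|].
  rewrite enormZ gtr0_norm// (le_trans _ (hb i Qi))//.
  by rewrite ler_piMl ?enorm_ge0.
rewrite mulrA mulrC ler_pM2r ?potential_gt0// cQ.
apply: (@le_trans _ _ (m.+1%:R + 4 * (c ^+ 2 * 3^-1 ^+ 2))).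
  rewrite lerD2l ler_pM2l//; under eq_bigr do rewrite enormZ exprMn real_normK ?num_real//.
  by rewrite -mulr_sumr ler_pM2l ?exprn_gt0.
(* Here (m + 1)(k/m - k/(m + 1)) = k/m = c, and c^2 <= c because k <= m; this form of the factor
   telescopes in [m]. *)
apply: (@le_trans _ _ (m.+1%:R * (1 + 4 / 9 * (k%:R / m%:R - k%:R / m.+1%:R)))); last first.
  by rewrite [leRHS]mulrC ler_pM2l// expR_ge1Dx.
rewrite mulrDr mulr1 lerD2l.
have -> : m.+1%:R * (4 / 9 * (k%:R / m%:R - k%:R / m.+1%:R)) = 4 / 9 * c.
  by rewrite /c -natr1; field; rewrite natr1 !gt_eqF.
have : c ^+ 2 <= c by rewrite expr2 ler_piMl// ltW.
lra.
Qed.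

(** The exponent is 1 + 4/9: 1 from the potential at the origin, 4/9 bounding the telescoped
    steps. *)
Lemma expR_13_9 : expR (13 / 9 : R) <= 8.
Proof.
have h (u : R) : u < 1 -> expR u <= (1 - u)^-1.
  move=> u1; rewrite -[leLHS]invrK -expRN lef_pV2 ?posrE ?expR_gt0//; last lra.
  exact: expR_ge1Dx.
have -> : 13 / 9 = 13 / 36 *+ 4 :> R by rewrite -mulr_natr; field.
rewrite -mulr_natl expRM_natl.
apply: (@le_trans _ _ ((36 / 23) ^+ 4)); last by rewrite !exprS expr0; lra.
have e1 : expR (13 / 36 : R) <= 36 / 23.
  have -> : 36 / 23 = (1 - 13 / 36)^-1 :> R by field.
  by apply: h; lra.
by rewrite lerXn2r ?nnegrE ?expR_ge0//; lra.
Qed.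

Hypothesis w_sum : \sum_i w i = 0.

(** Iterating the step from [k] up to [n] costs a total exponent 4/9 (1 - k/n). At [n] all vectors
    have been drawn, the sum vanishes, and each potential equals e. *)
Lemma sum_potential_le (k : nat) : (k <= n)%N ->
  \sum_(s : 'S_n) potential (psum s k) <= 8 * n`!%:R.
Proof.
move=> kn.
have sum0 : \sum_(s : 'S_n) potential (0 : 'rV[R]_d) = expR 1 * n`!%:R.
  by rewrite sumr_const card_Sn mulr_natr /potential enorm0 expr0n addr0 sqrtr1.
have [->|k0] := posnP k.
  under eq_bigr => s _ do [rewrite /psum big1//].
  rewrite sum0 ler_wpM2r// (le_trans _ expR_13_9)// ler_expR; lra.
have main m : (k <= m <= n)%N ->
  \sum_(s : 'S_n) potential (psum s k) <= expR (4 / 9 * (1 - k%:R / m%:R)) *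
    \sum_(s : 'S_n) potential ((k%:R / m%:R) *: psum s m).
  elim: m => [|m IH]; first by rewrite leqn0 => /andP[/eqP k00]; rewrite k00 in k0.
  case/andP; rewrite leq_eqVlt => /orP[/eqP <- _|].
    rewrite divff ?pnatr_eq0 -?lt0n// subrr mulr0 expR0 mul1r.
    by under [leRHS]eq_bigr do rewrite scale1r.
  rewrite ltnS => km mn.
  have {}IH := IH (introT andP (conj km (ltnW mn))).
  apply: (le_trans IH).
  have := @sum_potential_step k (Ordinal mn); rewrite /= k0 km => /(_ isT) h.
  rewrite -(ler_pM2l (expR_gt0 (4 / 9 * (1 - k%:R / m%:R)))) mulrA -expRD in h.
  apply: (le_trans h); rewrite le_eqVlt; apply/orP; left; apply/eqP.
  by congr (expR _ * _); ring.
apply: (le_trans (main n _)); first by rewrite kn leqnn.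
have pn s : psum s n = 0.
  rewrite /psum; under eq_bigl do rewrite ltn_ord.
  by rewrite -[RHS]w_sum [RHS](reindex_inj (@perm_inj _ s)).
under eq_bigr do rewrite pn scaler0.
rewrite sum0 mulrA -expRD ler_wpM2r// (le_trans _ expR_13_9)// ler_expR.
have : (0 : R) <= k%:R / n%:R by rewrite divr_ge0.
lra.
Qed.

End SamplingWithoutReplacement.

(** Exponential Markov inequality with a union bound over [k], counted over permutations so that it
    can be applied at each fixed value of the iterate. *)
Lemma perm_sum_concentration (R : realType) (d n : nat) (w : 'I_n -> 'rV[R]_d)
    (K delta : R) : (0 < n)%N -> 0 <= K -> 0 < delta < 1 ->
  \sum_i w i = 0 -> \sum_i enorm (w i) ^+ 2 <= K ^+ 2 ->
  (1 - delta) * n`!%:R <= \sum_(s : 'S_n)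
    [forall k : 'I_n, enorm (psum w s k) <= 3 * K * ln (8 * n%:R / delta)]%:R.
Proof.
move=> n0 K0 /andP[d0 d1] w0 wK; set l := ln _.
have nR : (1 : R) <= n%:R by rewrite ler1n.
have arg0 : 0 < 8 * n%:R / delta by rewrite divr_gt0//; lra.
have total : \sum_(s : 'S_n) (1 : R) = n`!%:R by rewrite sumr_const card_Sn.
(* For K = 0 all vectors vanish; otherwise dividing by 3 K brings the sum of squares down to 1/9. *)
have [K00|Kn0] := eqVneq K 0.
  have wi i : w i = 0.
    apply: enorm_eq0; apply/eqP; rewrite -sqrf_eq0 eq_le sqr_ge0 andbT.
    rewrite (le_trans _ (le_trans wK _)) ?K00 ?expr0n//.
    by rewrite (bigD1 i)//= lerDl sumr_ge0// => j _; exact: sqr_ge0.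
  rewrite (eq_bigr (fun=> 1)) ?total => [|s _]; first by rewrite ler_piMl//; lra.
  rewrite (_ : [forall k, _] = true)//; apply/forallP => k.
  by rewrite K00 mulr0 mul0r /psum big1 ?enorm0.
have Kgt0 : 0 < K by rewrite lt_def Kn0.
have K3 : 0 < (3 * K)^-1 by rewrite invr_gt0; lra.
pose w' i := (3 * K)^-1 *: w i.
have psum_w' s k : psum w' s k = (3 * K)^-1 *: psum w s k by rewrite /psum -scaler_sumr.
have w'K : \sum_i enorm (w' i) ^+ 2 <= 3^-1 ^+ 2.
  under eq_bigr do rewrite enormZ exprMn gtr0_norm//.
  rewrite -mulr_sumr invfM exprMn -mulrA ler_piMr ?sqr_ge0//.
  by rewrite exprVn mulrC ler_pdivrMr ?exprn_gt0// mul1r.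
have w'0 : \sum_i w' i = 0 by rewrite -scaler_sumr w0 scaler0.
pose good (s : 'S_n) := [forall k : 'I_n, enorm (psum w s k) <= 3 * K * l].
(* A bad permutation has some [k] whose rescaled partial sum exceeds ln(8 n / delta), so that one
   potential already dominates the left side. *)
have Markov (s : 'S_n) : (~~ good s)%:R * (8 * n%:R / delta) <=
    \sum_(k < n) potential (psum w' s k).
  have [|/forallPn[k]] := boolP (good s).
    by rewrite mul0r sumr_ge0// => k _; exact/ltW/potential_gt0.
  rewrite -ltNge => hk; rewrite mul1r (bigD1 k)//= ler_wpDr ?sumr_ge0//.
    by move=> j _; exact/ltW/potential_gt0.
  apply: le_trans (expR_enorm_le_potential _).
  rewrite -[leLHS]lnK ?posrE// ler_expR psum_w' enormZ gtr0_norm//.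
  by rewrite ler_pdivlMl ?ltW//; lra.
have bad : \sum_(s : 'S_n) (~~ good s)%:R <= delta * n`!%:R.
  rewrite -(ler_pM2r arg0) mulr_suml.
  apply: (le_trans (ler_sum _ (fun s _ => Markov s))).
  rewrite exchange_big/=.
  apply: (@le_trans _ _ (\sum_(k < n) 8 * n`!%:R)).
    by apply: ler_sum => k _; apply: sum_potential_le => //; exact: ltnW.
  rewrite sumr_const card_ord -mulr_natr le_eqVlt; apply/orP; left; apply/eqP.
  by field; rewrite gt_eqF.
have : \sum_(s : 'S_n) (good s)%:R = n`!%:R - \sum_(s : 'S_n) (~~ good s)%:R :> R.
  rewrite -total -sumrB; apply: eq_bigr => s _.
  by case: (good s); rewrite ?subr0 ?subrr.
lra.
Qed.

(** * Gradients of smooth functions bounded below *)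

Section Gradient.
Context {R : realType} {d : nat}.
Implicit Types (h : 'rV[R]_d -> R) (x v : 'rV[R]_d).

Lemma derive_grad h x v : differentiable h x -> 'D_v h x = dotv (grad h x) v.
Proof.
move=> hx; rewrite deriveE// [v in LHS]row_sum_delta linear_sum.
by apply: eq_bigr => i _; rewrite linearZ /= mxE deriveE// mulrC.
Qed.

Lemma is_derive_line h x v (s : R) : differentiable h (x + s *: v) ->
  is_derive s (1 : R) (fun u : R => h (x + u *: v)) (dotv (grad h (x + s *: v)) v).
Proof.
move=> hx; have E : (fun k : R => k^-1 *: (((fun u : R => h (x + u *: v)) \o shift s) (k *: 1)
     - h (x + s *: v))) =
    (fun k : R => k^-1 *: ((h \o shift (x + s *: v)) (k *: v) - h (x + s *: v))).
  apply/funext => k /=; congr (_ *: (h _ - _)).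
  by rewrite scalerDl -[k *: 1]/(k * 1) mulr1 addrCA addrA addrC addrA.
split; first by rewrite /derivable E; exact: diff_derivable.
by rewrite -derive_grad// /derive E.
Qed.

(** A gradient step of length 1/L decreases [h] by at least |g|^2 / (2 L), yet [h] stays above
    [b]. *)
Lemma lipschitz_grad_sqr_le h (L b : R) x : (forall y, differentiable h y) ->
  0 < L -> lipschitz_grad L h -> (forall y, b <= h y) ->
  enorm (grad h x) ^+ 2 <= 2 * L * (h x - b).
Proof.
move=> dh L0 Lh hb; set g := grad h x; set G := enorm g ^+ 2.
(* The descent inequality says psi(s) <= psi(0). By the Lipschitz bound psi' <= 0 for s > 0, so the
   mean value theorem on [0, 1/L] gives it without integration. *)
pose psi (s : R) := h (x + s *: (- g)) + (s * G - L * G / 2 * s ^+ 2).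
pose dpsi (s : R) := dotv (grad h (x + s *: (- g))) (- g) + (G - L * G * s).
have Hd (s : R) : is_derive s (1 : R) psi (dpsi s).
  apply: is_deriveD; first exact: is_derive_line.
  apply: is_derive_eq.
  by rewrite !scaler0 /GRing.scale/=; field.
have L1 : 0 < L^-1 by rewrite invr_gt0.
have [|c] := MVT L1 (fun s _ => Hd s).
  apply: continuous_subspaceT => s; apply: differentiable_continuous.
  by apply/derivable1_diffP; case: (Hd s).
rewrite in_itv/= => /andP[c0 _] E.
have : dpsi c <= 0.
  have -> : dpsi c = dotv (grad h (x + c *: (- g)) - g) (- g) - L * G * c.
    rewrite /dpsi dotvDl -enormE enormN -/G; ring.
  rewrite subr_le0 (le_trans (dotv_le _ _))// enormN.
  have := Lh (x + c *: (- g)) x; rewrite addrAC subrr add0r enormZ enormN gtr0_norm//.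
  move=> h1; apply: (@le_trans _ _ (L * (c * enorm g) * enorm g)).
    by rewrite ler_wpM2r ?enorm_ge0.
  by rewrite le_eqVlt /G; apply/orP; left; apply/eqP; ring.
move=> dc; have : psi L^-1 - psi 0 <= 0 by rewrite E pmulr_lle0 ?subr0.
rewrite /psi scale0r addr0 mul0r expr0n/= mulr0 subr0 addr0.
have := hb (x + L^-1 *: (- g)).
set z := h (x + _) => bz Hz.
have e : L^-1 * G - L * G / 2 * L^-1 ^+ 2 = G / (2 * L) by field; rewrite gt_eqF.
rewrite e in Hz; have : G / (2 * L) <= h x - b by lra.
by rewrite ler_pdivrMr ?mulr_gt0// mulrC.
Qed.

Lemma grad_favg n (f : 'I_n -> 'rV[R]_d -> R) x :
  (forall i, differentiable (f i) x) ->
  grad (favg f) x = n%:R^-1 *: \sum_i grad (f i) x.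
Proof.
move=> df; apply/rowP => j; rewrite mxE mxE summxE.
have dfj i : derivable (f i) x (delta_mx ord0 j) by exact: diff_derivable.
have -> : favg f = n%:R^-1 \*: \sum_(i < n) f i.
  by apply/funext => y; rewrite /favg fct_sumE.
rewrite deriveZ ?derive_sum//; last exact: derivable_sum.
by congr (_ * _); apply: eq_bigr => i _; rewrite mxE.
Qed.

(** Deviations from the mean gradient have at most the raw second moment; the gaps f_i - fbar_i then
    sum to n (f - fbar) plus the sum of fbar - fbar_i. *)
Lemma sum_grad_dev_le n (f : 'I_n -> 'rV[R]_d -> R) (L fbar : R) (fbar_ : 'I_n -> R) x :
  (0 < n)%N -> (forall i y, differentiable (f i) y) ->
  0 < L -> (forall i, lipschitz_grad L (f i)) -> (forall i y, fbar_ i <= f i y) ->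
  \sum_i enorm (grad (f i) x - grad (favg f) x) ^+ 2 <=
  n%:R * (2 * L * (favg f x - fbar) + 2 * L / n%:R * \sum_(i < n) (fbar - fbar_ i)).
Proof.
move=> n0 df L0 Lf fb; set g := grad (favg f) x.
have nR : (n%:R : R) != 0 by rewrite pnatr_eq0 -lt0n.
have Eg : \sum_i grad (f i) x = n%:R *: g.
  by rewrite /g grad_favg// scalerA mulfV// scale1r.
apply: (@le_trans _ _ (\sum_i enorm (grad (f i) x) ^+ 2)).
  have h i : enorm (grad (f i) x - g) ^+ 2 =
      enorm (grad (f i) x) ^+ 2 + enorm g ^+ 2 - 2 * dotv g (grad (f i) x).
    by rewrite enormD_sqr enormN [dotv _ (- g)]dotvC dotvNl; ring.
  under eq_bigr do rewrite h.
  rewrite sumrB big_split/= -(mulr_sumr _ _ _ 2) -dotv_sumr Eg dotvZr -enormE sumr_const.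
  rewrite card_ord -mulr_natl.
  have : 0 <= n%:R * enorm g ^+ 2 by rewrite mulr_ge0 ?sqr_ge0.
  lra.
apply: (le_trans (ler_sum _ (fun i _ => lipschitz_grad_sqr_le x (df i) L0 (Lf i) (fb i)))).
rewrite -mulr_sumr !sumrB sumr_const card_ord -mulr_natl /favg.
by rewrite le_eqVlt; apply/orP; left; apply/eqP; field.
Qed.

End Gradient.

(** * Deterministic error bound for one epoch *)

Section Epoch.
Context {R : realType} {d n : nat}.
Variable f : 'I_n -> 'rV[R]_d -> R.

Lemma rr_inner0 a (s : 'S_n) x : rr_inner f a s x 0 = x.
Proof. by rewrite /rr_inner take0. Qed.

Lemma rr_innerS a (s : 'S_n) x (k : 'I_n) :
  rr_inner f a s x k.+1 = rr_inner f a s x k - a *: grad (f (s k)) (rr_inner f a s x k).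
Proof.
by rewrite /rr_inner (take_nth k) ?size_enum_ord// foldl_rcons nth_ord_enum.
Qed.

Lemma rr_inner_sum a (s : 'S_n) x (k : nat) : (k <= n)%N ->
  rr_inner f a s x k =
  x - a *: \sum_(j < n | (j < k)%N) grad (f (s j)) (rr_inner f a s x j).
Proof.
elim: k => [|k IH] kn; first by rewrite rr_inner0 big1// scaler0 subr0.
rewrite (rr_innerS _ _ _ (Ordinal kn)) /= IH ?(ltnW kn)// -addrA -opprD -scalerDr.
congr (x - a *: _); rewrite [RHS](bigD1 (Ordinal kn))/= ?ltnS// addrC -IH ?(ltnW kn)//.
congr (_ + _); apply: eq_bigl => j.
by rewrite -val_eqE/= ltnS ltn_neqAle andbC.
Qed.

(** The total drift [W] of the inner points from [x] is bounded in terms of itself with factor a n L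
    <= 1/4; absorbing it yields 4/3, and |e| <= L W / n. *)
Lemma rr_error_le (L a M : R) (s : 'S_n) (x : 'rV[R]_d) :
  (0 < n)%N -> 0 < L -> (forall i, lipschitz_grad L (f i)) ->
  0 < a -> 4 * a * n%:R * L <= 1 ->
  grad (favg f) x = n%:R^-1 *: \sum_i grad (f i) x ->
  (forall k : 'I_n, enorm (psum (fun i => grad (f i) x - grad (favg f) x) s k) <= M) ->
  enorm (rr_e f a s x) <=
    4 / 3 * a * L * (n%:R / 2 * enorm (grad (favg f) x) + M).
Proof.
move=> n0 L0 Lf a0 anL Ef HM; set g := grad (favg f) x in Ef HM *.
have nR : (0 : R) < n%:R by rewrite ltr0n.
pose y (k : nat) := rr_inner f a s x k.
pose D (k : nat) := enorm (y k - x).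
pose W := \sum_(k < n) D k.
have D0 k : 0 <= D k by exact: enorm_ge0.
have W0 : 0 <= W by apply: sumr_ge0 => k _.
have M0 : 0 <= M by apply: le_trans (HM (Ordinal n0)); exact: enorm_ge0.
have Dk (k : 'I_n) : D k <= a * (k%:R * enorm g + M) + a * L * W.
  rewrite /D /y rr_inner_sum 1?ltnW// addrC addKr enormN enormZ gtr0_norm//.
  rewrite -mulrA -mulrDr ler_pM2l//.
  pose e j := grad (f (s j)) (y j) - grad (f (s j)) x.
  (* Each gradient on the path splits into the mean gradient, its deviation at [x], and the change
     [e j] due to drift. *)
  have -> : \sum_(j < n | (j < k)%N) grad (f (s j)) (rr_inner f a s x j) =
      (k%:R *: g + psum (fun i => grad (f i) x - g) s k) + \sum_(j < n | (j < k)%N) e j.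
    rewrite scaler_nat -{2}(card_ord_lt (ltnW (ltn_ord k))) -sumr_const -!big_split/=.
    by apply: eq_bigr => j _; rewrite /e /y [g + _]addrC subrK addrC subrK.
  rewrite (le_trans (ler_enormD _ _))// lerD//.
    by rewrite (le_trans (ler_enormD _ _))// lerD// enormZ ger0_norm.
  rewrite (le_trans (ler_enorm_sum _ _))// mulr_sumr.
  (* Adding the drifts from position [k] onwards makes the bound the same [W] for every [k]. *)
  rewrite [leRHS](bigID (fun j : 'I_n => (j < k)%N))/= ler_wpDr ?sumr_ge0//.
    by move=> j _; rewrite mulr_ge0// ltW.
  by apply: ler_sum => j _; exact: Lf.
have sumk m : \sum_(k < m) k%:R <= m%:R ^+ 2 / 2 :> R.
  elim: m => [|m IH]; first by rewrite big_ord0 expr0n mul0r.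
  by rewrite big_ord_recr/= -natr1; lra.
have HW : W <= 4 / 3 * (a * (n%:R ^+ 2 / 2 * enorm g + n%:R * M)).
  have : W <= a * (n%:R ^+ 2 / 2 * enorm g + n%:R * M) + a * n%:R * L * W.
    apply: (le_trans (ler_sum _ (fun k _ => Dk k))).
    rewrite big_split/= sumr_const card_ord -mulr_sumr big_split/= sumr_const.
    rewrite card_ord -mulr_suml -(mulr_natl M) -(mulr_natl (a * L * W)).
    apply: lerD; last by rewrite le_eqVlt; apply/orP; left; apply/eqP; ring.
    by rewrite ler_pM2l// lerD2r ler_wpM2r ?enorm_ge0 ?sumk.
  have : a * n%:R * L * W <= 4^-1 * W by rewrite ler_wpM2r//; lra.
  lra.
(* At the common point [x] the order of the components does not affect the average, so the error is
   the mean drift of the gradients. *)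
have -> : rr_e f a s x =
    n%:R^-1 *: \sum_(j < n) (grad (f (s j)) (y j) - grad (f (s j)) x).
  rewrite /rr_e /rr_g -/g Ef sumrB scalerBr; congr (_ - _ *: _).
  exact: reindex_inj (@perm_inj _ s).
rewrite enormZ gtr0_norm ?invr_gt0//.
apply: (@le_trans _ _ (n%:R^-1 * (L * W))).
  rewrite ler_pM2l ?invr_gt0// mulr_sumr (le_trans (ler_enorm_sum _ _))//.
  by apply: ler_sum => j _; exact: Lf.
rewrite mulrC ler_pdivrMr//.
apply: (@le_trans _ _ (L * (4 / 3 * (a * (n%:R ^+ 2 / 2 * enorm g + n%:R * M))))).
  by rewrite ler_pM2l.
by rewrite le_eqVlt; apply/orP; left; apply/eqP; field.
Qed.

End Epoch.

(** * Uniform choice independent of a family of events *)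

Section UniformChoice.
Context (R : realType) (disp : measure_display) (T : measurableType disp).
Variable P : probability T R.

Lemma sum_probability_indic (I : finType) (D : I -> set T) :
  (forall i, measurable (D i)) ->
  (\sum_(i : I) P (D i) = \int[P]_x (\sum_(i : I) \1_(D i) x)%:E)%E.
Proof.
move=> mD; under eq_integral do rewrite -sumEFin.
rewrite ge0_integral_sum// => [|i].
- by apply: eq_bigr => i _; rewrite integral_indic// setIT.
- by apply/measurable_EFinP; exact: measurable_indic.
Qed.

(** The target splits over the value [s] of [pi]; by independence each piece has probability P(D
    s)/n!. The total is the expected fraction of [s] with [x] in [D s], which is at least [c]
    pointwise, so no conditional expectation is needed. *)
Lemma probability_uniform_choice_ge (n : nat) (pi : T -> 'S_n)
    (D : 'S_n -> set T) (c : R) :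
  0 <= c -> (forall s, measurable (D s)) ->
  (forall s, measurable (pi @^-1` [set s])) ->
  (forall s, P (D s `&` pi @^-1` [set s]) = (P (D s) * (n`!%:R^-1)%:E)%E) ->
  (forall x, c * n`!%:R <= \sum_(s : 'S_n) \1_(D s) x) ->
  (c%:E <= P [set x | D (pi x) x])%E.
Proof.
move=> c0 mD mpi PD cD; pose F s := D s `&` pi @^-1` [set s].
have mF s : measurable (F s) by exact: measurableI.
have EF : [set x | D (pi x) x] = \big[setU/set0]_(s : 'S_n) F s.
  rewrite -bigcup_seq; apply/seteqP; split => x /=.
    by move=> Dx; exists (pi x) => //=; rewrite mem_index_enum.
  by case=> s _ [Ds /= pis]; rewrite pis.
have -> : P [set x | D (pi x) x] = (\sum_(s : 'S_n) P (F s))%E.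
  rewrite sum_probability_indic//.
  rewrite -[X in P X]setIT -integral_indic//; last first.
    by rewrite EF; exact: bigsetU_measurable.
  apply: eq_integral => x _; congr (_%:E).
  (* At each point only the index [s = pi x] contributes. *)
  rewrite (bigD1 (pi x))//= big1 => [|s spi].
    rewrite addr0 !indicE; congr ((_ : bool)%:R); apply/idP/idP; rewrite !inE/=.
      by split.
    by case.
  by rewrite indicE memNset// => -[_ /= E]; rewrite E eqxx in spi.
have n0 : (0 : R) < n`!%:R by rewrite ltr0n fact_gt0.
under eq_bigr do rewrite PD.
rewrite -ge0_sume_distrl//.
rewrite sum_probability_indic// lee_pdivlMr//.
apply: (@le_trans _ _ (\int[P]_x (cst (c * n`!%:R)%:E x))%E).
  by rewrite integral_cst//= probability_setT mule1.
apply: ge0_le_integral => //.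
- by move=> x _; rewrite lee_fin mulr_ge0.
- apply/measurable_EFinP; apply: measurable_sum => s.
  exact: measurable_indic.
- by move=> x _; rewrite lee_fin.
Qed.

End UniformChoice.

(** * Continuity of the epoch maps and measurability of the iterates *)

Section ContinuousMaps.
Context {K : numFieldType} {V : normedModType K} {X : topologicalType}.
Implicit Types F G : X -> V.

Lemma continuous_sub F G :
  continuous F -> continuous G -> continuous (fun x => F x - G x).
Proof. by move=> cF cG x; apply: cvgB; [exact: cF|exact: cG]. Qed.

Lemma continuous_scale (a : K) F : continuous F -> continuous (fun x => a *: F x).
Proof. by move=> cF x; apply: cvgZr; exact: cF. Qed.

Lemma continuous_sum (I : finType) (F : I -> X -> V) :
  (forall i, continuous (F i)) -> continuous (fun x => \sum_i F i x).
Proof. by move=> cF; apply: continuous_big => //; exact: add_continuous. Qed.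

Lemma continuous_compose (Y : topologicalType) (g : Y -> V) (F : X -> Y) :
  continuous F -> continuous g -> continuous (fun x => g (F x)).
Proof. by move=> cF cg x; apply: continuous_comp; [exact: cF|exact: cg]. Qed.

End ContinuousMaps.

Section Continuity.
Context {R : realType} {d n : nat}.
Variable f : 'I_n -> 'rV[R]_d -> R.
Hypothesis f_diff : forall i, cont_diff (f i).

Lemma enorm_sqr_continuous (T : topologicalType) (F : T -> 'rV[R]_d) :
  continuous F -> continuous (fun x => enorm (F x) ^+ 2).
Proof.
move=> cF; under [X in continuous X]funext do rewrite enormE.
have cFi i : continuous (fun x => F x ord0 i).
  move=> x; apply: (@continuous_comp _ _ _ F (fun M : 'rV[R]_d => M ord0 i)).
    exact: cF.
  exact: coord_continuous.
by apply: continuous_sum => i x; apply: cvgM; exact: cFi.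
Qed.

Lemma rr_inner_continuous a (s : 'S_n) (k : nat) : (k <= n)%N ->
  continuous (fun x => rr_inner f a s x k).
Proof.
elim: k => [|k IH] kn.
  by under [X in continuous X]funext do rewrite rr_inner0; move=> x; exact: cvg_id.
under [X in continuous X]funext do rewrite (rr_innerS _ _ _ _ (Ordinal kn)) /=.
have cy := IH (ltnW kn); apply: continuous_sub => //; apply: continuous_scale.
by apply: continuous_compose => //; exact: (f_diff _).2.
Qed.

Lemma grad_favg_continuous : continuous (grad (favg f)).
Proof.
under [X in continuous X]funext => x do
  rewrite (grad_favg (fun i => (f_diff i).1 x)).
by apply/continuous_scale/continuous_sum => i; exact: (f_diff i).2.
Qed.

Lemma favg_continuous : continuous (favg f).
Proof.
apply: (@continuous_scale R R^o); apply: (@continuous_sum R R^o) => i y.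
exact/differentiable_continuous/(f_diff i).1.
Qed.

Lemma rr_e_continuous a (s : 'S_n) : continuous (rr_e f a s).
Proof.
apply: continuous_sub; last exact: grad_favg_continuous.
apply/continuous_scale/continuous_sum => i; apply: continuous_compose.
  by apply: rr_inner_continuous; exact: ltnW.
exact: (f_diff _).2.
Qed.

(** Induction on [t], splitting by the last permutation: for each fixed one the epoch map is
    continuous, so it pulls [U] back to an open set of values of the previous iterate. *)
Lemma rr_past_iter (T : pointedType) (x0 : T -> 'rV[R]_d) (pi : nat -> T -> 'S_n)
    (alpha : nat -> R) (t : nat) (U : set 'rV[R]_d) : open U ->
  rr_past x0 pi t (rr_iter f alpha x0 pi t @^-1` U).
Proof.
elim: t U => [|t IH] U oU.
  by apply: sub_sigma_algebra; left; exists U.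
have past_le : rr_past x0 pi t `<=` rr_past x0 pi t.+1.
  apply: sub_sigma_algebra2 => E [?|[u [s [ut ->]]]]; [by left|right].
  by exists u, s; split=> //; exact: ltnW.
pose V s := (fun x => rr_inner f (alpha t) s x n) @^-1` U.
have oV s : open (V s).
  by apply: open_comp => // x _; exact: rr_inner_continuous.
pose F s := pi t @^-1` [set s] `&` rr_iter f alpha x0 pi t @^-1` V s.
have -> : rr_iter f alpha x0 pi t.+1 @^-1` U = \big[setU/set0]_(s : 'S_n) F s.
  rewrite -bigcup_seq; apply/seteqP; split => w /=.
    by move=> Uw; exists (pi t w) => //=; rewrite mem_index_enum.
  by case=> s _ [/= pis]; rewrite /V /= -pis.
rewrite /rr_past; set G := (X in <<s X >>).
suff : @measurable _ (g_sigma_algebraType G) (\big[setU/set0]_(s : 'S_n) F s) by [].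
apply: bigsetU_measurable => s _; apply: (@measurableI _ (g_sigma_algebraType G)).
  by apply: sub_sigma_algebra; right; exists t, s.
exact: (past_le _ (IH _ (oV s))).
Qed.

End Continuity.

(** * The squared error bound and its probability *)

Lemma rr_error_sqr_le (R : realType) (d n : nat) (f : 'I_n -> 'rV[R]_d -> R)
    (L a V l : R) (s : 'S_n) (x : 'rV[R]_d) :
  (0 < n)%N -> (forall i, differentiable (f i) x) -> 0 < L ->
  (forall i, lipschitz_grad L (f i)) ->
  0 < a -> 4 * a * n%:R * L <= 1 -> 0 <= V ->
  (forall k : 'I_n, enorm (psum (fun i => grad (f i) x - grad (favg f) x) s k) <=
     3 * Num.sqrt (n%:R * V) * l) ->
  enorm (rr_e f a s x) ^+ 2 <=
    2 * a ^+ 2 * n%:R ^+ 2 * L ^+ 2 * enorm (grad (favg f) x) ^+ 2 +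
    32 * a ^+ 2 * n%:R * L ^+ 2 * V * l ^+ 2.
Proof.
move=> n0 df L0 Lf a0 anL V0 Hl.
have := rr_error_le n0 L0 Lf a0 anL (grad_favg df) Hl.
set G := enorm (grad _ _); set M := 3 * _ * l => h.
have -> : 32 * a ^+ 2 * n%:R * L ^+ 2 * V * l ^+ 2 =
    32 / 9 * (a ^+ 2 * L ^+ 2) * M ^+ 2.
  (* The factor 3 in [M] squares to 9, which turns 32/9 into the stated 32. *)
  have -> : M ^+ 2 = 9 * (n%:R * V) * l ^+ 2.
    by rewrite /M !exprMn sqr_sqrtr ?mulr_ge0//; ring.
  by field.
apply: (@le_trans _ _ ((4 / 3 * a * L * (n%:R / 2 * G + M)) ^+ 2)).
  rewrite lerXn2r ?nnegrE ?enorm_ge0//.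
  exact: le_trans (enorm_ge0 _) h.
have aL : 0 <= a ^+ 2 * L ^+ 2 by rewrite mulr_ge0 ?sqr_ge0.
(* This yields (p + q)^2 <= 2 p^2 + 2 q^2. With (4/3)^2 it gives 8/9 n^2 G^2 + 32/9 M^2, and the
   next square raises 8/9 to 2. *)
have : 0 <= a ^+ 2 * L ^+ 2 * (n%:R / 2 * G - M) ^+ 2 by rewrite mulr_ge0 ?sqr_ge0.
have : 0 <= a ^+ 2 * L ^+ 2 * (n%:R * G) ^+ 2 by rewrite mulr_ge0 ?sqr_ge0.
lra.
Qed.

Theorem corollary2p3 (R : realType) (d n : nat) (n_gt0 : (0 < n)%N)
  (f : 'I_n -> 'rV[R]_d -> R) (L : R) (fbar_ : 'I_n -> R) (fbar : R)
  (disp : measure_display) (T : measurableType disp) (P : probability T R)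
  (x0 : T -> 'rV[R]_d) (pi : nat -> T -> 'S_n) (alpha : nat -> R)
  (t : nat) (delta : R) :
  (forall i, cont_diff (f i)) ->
  (forall i x, fbar_ i <= f i x) ->
  0 < L ->
  (forall i, lipschitz_grad L (f i)) ->
  (forall x, fbar <= favg f x) ->
  let A := 2 * L in
  let B := A / n%:R * \sum_(i < n) (fbar - fbar_ i) in
  0 <= B ->
  rr_sampling P x0 pi ->
  0 < delta < 1 ->
  0 < alpha t ->
  4 * alpha t * n%:R * L <= 1 ->
  let x := rr_iter f alpha x0 pi in
  let e := fun w => rr_e f (alpha t) (pi t w) (x t w) in
  ((1 - delta)%:E <=
   P [set w | (enorm (e w) ^+ 2 <=
       2 * alpha t ^+ 2 * n%:R ^+ 2 * L ^+ 2
         * enorm (grad (favg f) (x t w)) ^+ 2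
       + 32 * alpha t ^+ 2 * n%:R * L ^+ 2
         * (A * (favg f (x t w) - fbar) + B)
         * ln (8 * n%:R / delta) ^+ 2)%R])%E.
Proof.
move=> f_diff f_lb L0 Lf f_ge A B B0 [mx0 mpi pi_unif pi_indep] delta01 a0 anL.
lazy zeta; set x := rr_iter f alpha x0 pi.
have df i y : differentiable (f i) y := (f_diff i).1 y.
pose V y := A * (favg f y - fbar) + B.
have V0 y : 0 <= V y.
  by rewrite addr_ge0// mulr_ge0 ?subr_ge0// mulr_ge0// ltW.
pose rhs y := 2 * alpha t ^+ 2 * n%:R ^+ 2 * L ^+ 2 * enorm (grad (favg f) y) ^+ 2 +
  32 * alpha t ^+ 2 * n%:R * L ^+ 2 * V y * ln (8 * n%:R / delta) ^+ 2.
pose C s : set 'rV[R]_d := [set y | enorm (rr_e f (alpha t) s y) ^+ 2 <= rhs y].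
pose D s := x t @^-1` C s.
(* The bound fails where one continuous function strictly exceeds another; hence [D s] belongs to
   the past, and independence from [pi t] applies to it. *)
have oC s : open (~` C s).
  have -> : ~` C s =
      (fun y => enorm (rr_e f (alpha t) s y) ^+ 2 - rhs y) @^-1` [set r | 0 < r].
    by apply/seteqP; split => y /=; rewrite subr_gt0 ltNge => /negP.
  apply: open_comp; last exact: open_gt.
  move=> y _; apply: (@continuous_sub R R^o).
    exact/enorm_sqr_continuous/rr_e_continuous.
  have affine (X : topologicalType) (F G : X -> R) (c1 c2 c3 : R) :
      continuous F -> continuous G ->
      continuous (fun z => c1 * F z + c2 * (A * (G z - fbar) + B) * c3).
    move=> cF cG z; apply: cvgD; first by apply: cvgMr; exact: cF.
    apply: cvgMl; apply: cvgMr; apply: cvgD; last exact: cvg_cst.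
    by apply: cvgMr; apply: cvgB; [exact: cG|exact: cvg_cst].
  apply: affine; last exact: favg_continuous.
  exact/enorm_sqr_continuous/grad_favg_continuous.
have pastD s : rr_past x0 pi t (D s).
  rewrite -[D s]setCK; apply: sigma_algebraC.
  exact: (@rr_past_iter R d n f f_diff T x0 pi alpha t _ (oC s)).
have past_measurable E : rr_past x0 pi t E -> measurable E.
  apply: smallest_sub; first exact: sigma_algebra_measurable.
  by move=> F [[U oU ->]|[u [s [_ ->]]]]; [exact: mx0|exact: mpi].
apply: (@probability_uniform_choice_ge _ _ _ _ _ (pi t) D).
- by case/andP: delta01 => _ /ltW; rewrite subr_ge0.
- by move=> s; exact: past_measurable.
- exact: mpi.
- by move=> s; rewrite pi_indep// pi_unif.
(* With the iterate frozen at [y], it remains to count the permutations that satisfy the bound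
   there. *)
move=> w; set y := x t w; have [d0 d1] := andP delta01.
apply: (le_trans (@perm_sum_concentration R d n
  (fun i => grad (f i) y - grad (favg f) y) (Num.sqrt (n%:R * V y)) delta
  n_gt0 (sqrtr_ge0 _) delta01 _ _)).
- rewrite sumrB sumr_const card_ord grad_favg// -scaler_nat scalerA mulfV ?scale1r ?subrr//.
  by rewrite pnatr_eq0 -lt0n.
- by rewrite sqr_sqrtr ?mulr_ge0//; exact: sum_grad_dev_le.
apply: ler_sum => s _; rewrite indicE.
case: forallP => [h|_]; last by rewrite ler0n.
rewrite mem_set//; exact: (rr_error_sqr_le n_gt0 (df^~ y) L0 Lf a0 anL (V0 y) h).
Qed.
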